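(* For every pair of real numbers $s<t$ there exist constants $c$ and $0<\rho<1$, depending only on $s,t$ (for a fixed choice of the universal Turing machine defining $\kappa$), such that the following holds. Let $(X_n)_{n=1}^\infty$ be a stationary $\{0,1\}$-valued process and let $S_n=\frac1n\kappa(X_1,\dots,X_n)$. Then for every positive integer $k$, $$\mathbb P\big((S_n)_{n=1}^\infty \text{ has } k\text{ upcrossings of }[s,t]\big)<c\cdot\rho^k .$$
   Context: Fix a universal Turing machine $U$. For a finite $0,1$-valued string $x$, let $x^*$ be a binary string of minimal length such that $U$ run on input $x^*$ outputs $x$; the Kolmogorov complexity $\kappa(x)$ is the length of $x^*$. (Changing $U$ changes $\kappa$ only by an additive constant.) A sequence $(x_n)_{n=1}^\infty$ of real numbers has $k$ upcrossings of $[s,t]$ if there are indices $1\le i_1<j_1<i_2<j_2<\cdots<i_k<j_k$ such that $x_{i_m}<s$ and $x_{j_m}>t$ for $m=1,\dots,k$. *)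

(* Defs.v *)
From HB Require Import structures.
From mathcomp Require Import all_boot all_order all_algebra.
From mathcomp Require Import all_classical all_reals all_analysis.

Set Implicit Arguments.
Unset Strict Implicit.
Unset Printing Implicit Defensive.

Import Order.TTheory GRing.Theory Num.Theory.

Local Open Scope classical_set_scope.
Local Open Scope ring_scope.

Inductive move := MoveL | Stay | MoveR.

(* The tape alphabet with extra symbols [S]: [None] is the blank,
   [Some (inl b)] is the binary digit [b]. *)
Definition cell (S : Type) := option (bool + S).

(* Deterministic multi-tape Turing machine, with [tapes.+1] tapes. *)
Record turing_machine := TuringMachine {
  state : finType;
  extra : finType;
  tapes : nat;
  start : state;
  halting : pred state;
  trans : state -> ('I_tapes.+1 -> cell extra) ->
          state * ('I_tapes.+1 -> cell extra * move)
}.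

(* A two-way infinite tape, in coordinates relative to the head: the head
   always scans cell [0], and it is the tape that is shifted. *)
Definition tape (S : Type) := int -> cell S.

Definition blank_tape (S : Type) : tape S := fun=> None.

Definition update_tape (S : Type) (t : tape S) (am : cell S * move) : tape S :=
  let t' z := if z == 0 then am.1 else t z in
  match am.2 with
  | MoveL => fun z => t' (z - 1)
  | Stay => t'
  | MoveR => fun z => t' (z + 1)
  end.

Definition input_tape (S : Type) (y : seq bool) : tape S := fun z =>
  match z with
  | Posz n => if (n < size y)%N then Some (inl (nth false y n)) else None
  | Negz _ => None
  end.

(* [x] is the maximal block of binary digits starting at the head. *)
Definition tape_reads (S : Type) (t : tape S) (x : seq bool) : Prop :=
  (forall n : nat, (n < size x)%N -> t n%:Z = Some (inl (nth false x n))) /\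
  (forall b : bool, t (size x)%:Z <> Some (inl b)).

Definition config (M : turing_machine) : Type :=
  (state M * ('I_(tapes M).+1 -> tape (extra M)))%type.

Definition init_config (M : turing_machine) (y : seq bool) : config M :=
  (start M, fun i => if i == ord0 then input_tape _ y else blank_tape _).

Definition step (M : turing_machine) (c : config M) : config M :=
  if halting c.1 then c else
  let q := trans c.1 (fun i => c.2 i 0) in
  (q.1, fun i => update_tape (c.2 i) (q.2 i)).

(* [M] run on input [y] halts with output [x]. The input is written on the
   first tape and the output is read on the last one (the same tape when
   [tapes M = 0]). *)
Definition outputs (M : turing_machine) (y x : seq bool) : Prop :=
  exists n : nat, let c := iter n (@step M) (init_config M y) in
    halting c.1 /\ tape_reads (c.2 ord_max) x.

(* [U] simulates every machine [M], given a self-delimiting description [e]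
   of [M] in front of the input. *)
Definition universal (U : turing_machine) : Prop :=
  forall M : turing_machine, exists e : seq bool,
    forall y x : seq bool, outputs U (e ++ y) x <-> outputs M y x.

(* Total; the value is meaningful when some program outputs [x], which is
   always the case if [U] is universal. *)
Definition kolmogorov (U : turing_machine) (x : seq bool) : nat :=
  xget 0%N [set n : nat |
    (exists2 y, outputs U y x & size y = n) /\
    (forall y, outputs U y x -> (n <= size y)%N)].

(* [x 0] is ignored: the sequence is [(x n)_(n >= 1)]. *)
Definition has_upcrossings (R : realType) (x : nat -> R) (s t : R) (k : nat)
  : Prop :=
  exists i j : nat -> nat,
    [/\ (1 <= i 0)%N,
        forall m, (m < k)%N -> (i m < j m)%N,
        forall m, (m.+1 < k)%N -> (j m < i m.+1)%N
      & forall m, (m < k)%N -> x (i m) < s /\ t < x (j m)].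

(* In a process [X], the variable [X n] stands for $X_{n+1}$. *)
Definition stationary (d : measure_display) (T : measurableType d)
    (R : realType) (P : probability T R) (X : nat -> {RV P >-> bool}) : Prop :=
  forall (m n : nat) (A : set (seq bool)),
    P [set w | A (mkseq (fun i => X (m + i)%N w) n)] =
    P [set w | A (mkseq (fun i => X i w) n)].

(* $\frac1n \kappa(X_1,\dots,X_n)$, for [n >= 1] *)
Definition complexity_rate (U : turing_machine) (R : realType) (T : Type)
    (X : nat -> T -> bool) (w : T) (n : nat) : R :=
  (kolmogorov U (mkseq (fun i => X i w) n))%:R / n%:R.

(* Main.v *)
Require Import Defs.
From HB Require Import structures.
From mathcomp Require Import all_boot all_order all_algebra.
From mathcomp Require Import all_classical all_reals all_analysis.
From mathcomp Require Import measurable_realfun zify ring lra.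

Import Order.TTheory GRing.Theory Num.Theory.
Local Open Scope classical_set_scope.
Local Open Scope ring_scope.

(** Call the word $x_n \dots x_{n+l-1}$ low if its complexity is below $sl$ and
    high if it exceeds $tl$.  An upcrossing of the complexity rate seen from
    position $n$ is a low word starting at $n$ followed by a longer high word
    starting at $n$.

    The link between low and high words is that complexity is subadditive up
    to an arbitrarily small proportion: a program for $x_1 x_2$ is a
    self-delimiting form of a program for $x_1$ followed by a program for $x_2$
    ([kolmogorov_cat], by an explicit Turing machine).  Hence a word mostly
    covered by disjoint long low words has rate below $t$, that is, disjoint
    long low words cover at most a proportion $1 - \delta$ of any high word
    ([high_unfilled]).  Applied to a single low word this also shows that
    lengths grow geometrically from one upcrossing to the next, so that after
    discarding all but a fixed proportion of the upcrossings each length may be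
    assumed much larger than the preceding one.

    Let $A$ be the set of positions in $[0, N)$ from which $k$ upcrossings are
    seen within distance $M$.  Starting from the points of $A$, viewed as
    disjoint intervals of length 1, one builds disjoint families of intervals
    issued from points of $A$, alternately low and high.  Passing to a next
    level of much longer intervals never loses more than a small proportion of
    the total length ([jump_cover]), and passing from low to high intervals
    multiplies it by almost $1/(1 - \delta)$, because the low intervals leave a
    proportion $\delta$ of each high one uncovered ([packed_growth]).  All
    intervals lie in $[0, N + M)$, so the size of $A$ is at most
    $\gamma^K (N + M)$ for some $\gamma < 1$, where $K$ grows linearly with $k$
    ([packed_tower], [upcrossing_count]).

    By stationarity the probability of $k$ upcrossings before $M$ is the
    expected proportion of such positions among the first $N$
    ([upcrossing_probability]); with $N > M$ this gives a bound that does not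
    depend on $M$, which may then tend to infinity. *)

Set Implicit Arguments.
Unset Strict Implicit.
Unset Printing Implicit Defensive.

(** * Tapes with finitely many written cells *)

Section Tapes.
Variable S : Type.
Implicit Types (l r : seq (cell S)) (t : tape S) (a : cell S).

Definition digit (b : bool) : cell S := Some (inl b).

(** The head scans the first cell of [r]; [l] lists the cells to its left,
    nearest first; every other cell is blank. *)
Definition zipper l r : tape S := fun z =>
  match z with Posz n => nth None r n | Negz n => nth None l n end.

Lemma update_stay t : update_tape t (t 0, Stay) = t.
Proof. by apply/funext => z; rewrite /update_tape /=; case: eqP => [->|]. Qed.

Lemma update_right l r a :
  update_tape (zipper l r) (a, MoveR) = zipper (a :: l) (behead r).
Proof.
have shift z : update_tape (zipper l r) (a, MoveR) z =
    if z + 1 == 0 then a else zipper l r (z + 1) by [].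
apply/funext; case => [n|[|n]]; rewrite shift //.
- by rewrite (_ : n%:Z + 1 = n.+1%:Z) ?[RHS]/= ?nth_behead //; lia.
- by rewrite (_ : Negz n.+1 + 1 = Negz n) //; lia.
Qed.

Lemma update_left l r a :
  update_tape (zipper l r) (a, MoveL) =
  zipper (behead l) (head None l :: a :: behead r).
Proof.
have shift z : update_tape (zipper l r) (a, MoveL) z =
    if z - 1 == 0 then a else zipper l r (z - 1) by [].
apply/funext; case => [[|[|n]]|n]; rewrite shift //.
- by rewrite (_ : n.+2%:Z - 1 = n.+1%:Z) ?[RHS]/= ?nth_behead //; lia.
- by rewrite (_ : Negz n - 1 = Negz n.+1) ?[RHS]/= ?nth_behead //; lia.
Qed.

Lemma blank_zipper : blank_tape S = zipper [::] [::].
Proof. by apply/funext; case => [n|n]; rewrite /= nth_nil. Qed.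

Lemma input_zipper (y : seq bool) :
  input_tape S y = zipper [::] (map digit y).
Proof.
apply/funext; case => [n|n] /=; rewrite ?nth_nil //.
case: ltnP => h; first by rewrite (nth_map false).
by rewrite nth_default // size_map.
Qed.

Lemma nth_rcons_blank l n : nth None (rcons l None) n = nth None l n.
Proof.
rewrite nth_rcons; case: ltngtP => // h; rewrite nth_default //.
- exact: ltnW.
- by rewrite h.
Qed.

Lemma zipper_blankl l r : zipper (rcons l None) r = zipper l r.
Proof. by apply/funext; case => [n|n] //=; rewrite nth_rcons_blank. Qed.

Lemma zipper_blankr l r : zipper l (rcons r None) = zipper l r.
Proof. by apply/funext; case => [n|n] //=; rewrite nth_rcons_blank. Qed.

Lemma zipper_reads l (x : seq bool) : tape_reads (zipper l (map digit x)) x.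
Proof.
split=> [n h|b] /=; first by rewrite (nth_map false).
by rewrite nth_default ?size_map.
Qed.

End Tapes.

(** * Machines whose tapes carry names *)

Section RoleMachine.
Variables (Q E J : finType) (jin jout : J) (q0 : Q) (hlt : pred Q).
Variable tr : Q -> (J -> cell E) -> Q * (J -> cell E * move).
Hypothesis jinout : jout != jin.

(** Machines are easier to program when their tapes are indexed by a finite
    type of names.  The input tape [jin] is listed first and only once, since
    all other tapes start blank; the last index falls past the end of the
    list, so that it receives the default name [jout]. *)
Definition role_seq : seq J := jin :: [seq j <- enum J | j != jin].
Definition role (i : 'I_#|J|.+1) : J := nth jout role_seq i.
Definition role_index (j : J) : 'I_#|J|.+1 := inord (index j role_seq).

Lemma size_role_seq : (size role_seq <= #|J|)%N.
Proof.
rewrite /= size_filter cardT -(count_predC (fun j => j != jin) (enum J)).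
rewrite -addn1 leq_add2l -has_count; apply/hasP; exists jin.
  by rewrite mem_enum.
by rewrite /= negbK.
Qed.

Lemma role_indexK j : role (role_index j) = j.
Proof.
have js : j \in role_seq by rewrite inE mem_filter mem_enum; case: eqP.
rewrite /role /role_index inordK ?nth_index //.
by rewrite ltnS (leq_trans _ size_role_seq) // ltnW // index_mem.
Qed.

Lemma role_max : role ord_max = jout.
Proof. by rewrite /role nth_default // size_role_seq. Qed.

Lemma role_in i : (role i == jin) = (i == ord0).
Proof.
case: i => -[|i] ilt; first by rewrite /role /= !eqxx.
rewrite -(inj_eq val_inj) /= /role /=.
case: (ltnP i (size [seq j <- enum J | j != jin])) => h.
  have := mem_nth jout h; rewrite mem_filter => /andP[/negbTE-> _] //.
by rewrite nth_default // (negbTE jinout).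
Qed.

Definition role_machine : turing_machine :=
  @TuringMachine Q E #|J| q0 hlt (fun q rd =>
    let r := tr q (fun j => rd (role_index j)) in (r.1, fun i => r.2 (role i))).

Definition role_step (c : Q * (J -> tape E)) : Q * (J -> tape E) :=
  if hlt c.1 then c else
  let r := tr c.1 (fun j => c.2 j 0) in
  (r.1, fun j => update_tape (c.2 j) (r.2 j)).

Definition role_config (c : Q * (J -> tape E)) : config role_machine :=
  (c.1, fun i => c.2 (role i)).

Lemma role_stepE c : step (role_config c) = role_config (role_step c).
Proof.
rewrite /step /role_step /role_config /=; case: ifP => // _ /=.
by under [fun j => c.2 (role (role_index j)) 0]funext do rewrite role_indexK.
Qed.

Definition reach c c' := exists n, iter n role_step c = c'.

Lemma reach_refl c : reach c c. Proof. by exists 0%N. Qed.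

Lemma reach_trans c1 c2 c3 : reach c1 c2 -> reach c2 c3 -> reach c1 c3.
Proof. by move=> [n <-] [m <-]; exists (m + n)%N; rewrite iterD. Qed.

Lemma reach_step c c' : reach (role_step c) c' -> reach c c'.
Proof. by move=> [n <-]; exists n.+1; rewrite iterSr. Qed.

Definition tape_set (tau : J -> tape E) j t : J -> tape E :=
  fun j' => if j' == j then t else tau j'.

(** Runs may be carried out on tapes indexed by names: reading one
    representative of each name and acting on all its copies keeps the copies
    equal. *)
Lemma role_outputs y x c :
  reach (q0, tape_set (fun=> blank_tape E) jin (input_tape E y)) c ->
  hlt c.1 -> tape_reads (c.2 jout) x -> outputs role_machine y x.
Proof.
move=> [n nE] hc rc; exists n.
have -> : init_config role_machine y =
    role_config (q0, tape_set (fun=> blank_tape E) jin (input_tape E y)).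
  rewrite /init_config /role_config /=; congr pair; apply/funext => i.
  by rewrite /tape_set role_in.
have it m c0 : iter m (@step role_machine) (role_config c0) =
    role_config (iter m role_step c0).
  by elim: m => //= m ->; rewrite role_stepE.
by rewrite it nE /= role_max.
Qed.

Definition act1 j v (rd : J -> cell E) : J -> cell E * move :=
  fun j' => if j' == j then v else (rd j', Stay).

Definition act2 j1 v1 j2 v2 (rd : J -> cell E) : J -> cell E * move :=
  fun j' => if j' == j1 then v1 else if j' == j2 then v2 else (rd j', Stay).

Lemma update_act1 tau j v :
  (fun j' => update_tape (tau j') (act1 j v (fun i => tau i 0) j')) =
  tape_set tau j (update_tape (tau j) v).
Proof.
apply/funext => j'; rewrite /act1 /tape_set; case: eqP => [->//|_].
by rewrite update_stay.
Qed.

Lemma update_act2 tau j1 v1 j2 v2 :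
  (fun j' => update_tape (tau j') (act2 j1 v1 j2 v2 (fun i => tau i 0) j')) =
  tape_set (tape_set tau j2 (update_tape (tau j2) v2)) j1
    (update_tape (tau j1) v1).
Proof.
apply/funext => j'; rewrite /act2 /tape_set; case: eqP => [->//|_].
by case: eqP => [->//|_]; rewrite update_stay.
Qed.

Lemma tape_setK tau j t t' : tape_set (tape_set tau j t) j t' = tape_set tau j t'.
Proof. by apply/funext => j'; rewrite /tape_set; case: eqP. Qed.

Lemma tape_setC tau j1 t1 j2 t2 : j1 != j2 ->
  tape_set (tape_set tau j1 t1) j2 t2 = tape_set (tape_set tau j2 t2) j1 t1.
Proof.
move=> ne; apply/funext => j'; rewrite /tape_set.
by case: eqP => // ->; rewrite eq_sym (negbTE ne).
Qed.

Lemma tape_set_eq tau j t : tape_set tau j t j = t.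
Proof. by rewrite /tape_set eqxx. Qed.

Lemma tape_set_id tau j : tape_set tau j (tau j) = tau.
Proof. by apply/funext => j'; rewrite /tape_set; case: eqP => [->|]. Qed.

End RoleMachine.

(** * A machine that concatenates the outputs of two programs *)

Section Concat.
Variables (U : turing_machine) (q : nat).

(** The input is a code of a program $p_1$ followed by a program $p_2$.
    [Decode] erases the code while writing $p_1$ on a fresh tape, so that the
    input tape ends up holding exactly $p_2$.  The code of $p_1$ is a list of
    chunks, each preceded by a bit 1: chunks of [q.+1] bits, then a bit 0, then
    chunks of a single bit, then a bit 0.  The boolean of [Decode] tells
    whether chunks are still long, and its counter is the number of bits left
    in the current chunk.  [Run] executes both programs in lockstep on two
    separate sets of tapes, [Copy] appends the two results to the output tape,
    and [Rewind] brings a head back to the start of a word. *)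
Inductive phase :=
  | Decode of bool & 'I_q.+2
  | Rewind of bool
  | Run of state U & state U
  | Copy of bool
  | Done.

Definition phase_code (p : phase) :
  (bool * 'I_q.+2) + bool + (state U * state U) + option bool :=
  match p with
  | Decode ph k => inl (inl (inl (ph, k)))
  | Rewind b => inl (inl (inr b))
  | Run s1 s2 => inl (inr (s1, s2))
  | Copy b => inr (Some b)
  | Done => inr None
  end.

Definition phase_decode c : phase :=
  match c with
  | inl (inl (inl (ph, k))) => Decode ph k
  | inl (inl (inr b)) => Rewind b
  | inl (inr (s1, s2)) => Run s1 s2
  | inr (Some b) => Copy b
  | inr None => Done
  end.

Lemma phase_codeK : cancel phase_code phase_decode.
Proof. by case. Qed.

HB.instance Definition _ := Finite.copy phase (can_type phase_codeK).

Let E := extra U.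
(** [Some (b, i)] is the tape [i] of the copy of [U] that runs the first
    ([b = true]) or the second program; [None] is the output tape. *)
Definition track : finType := option (bool * 'I_(tapes U).+1).
Implicit Types rd : track -> cell E.
Definition t_in : track := Some (false, ord0).
Definition t_first : track := Some (true, ord0).
Definition t_out : track := None.
Definition t_result (b : bool) : track := Some (b, ord_max).
Definition t_rewind (b : bool) := if b then t_first else t_out.

Definition next_state (s : state U) (rd : 'I_(tapes U).+1 -> cell E) :=
  if halting s then (s, fun i => (rd i, Stay)) else trans s rd.

Definition idle rd : track -> cell E * move := fun j => (rd j, Stay).

Definition concat_trans (p : phase) rd : phase * (track -> cell E * move) :=
  match p with
  | Decode ph k =>
      if rd t_in is Some (inl b) then
        if k == ord0 then
          if b then (Decode ph (if ph then ord_max else inord 1),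
                     act1 t_in (None, MoveR) rd)
          else if ph then (Decode false ord0, act1 t_in (None, MoveR) rd)
          else (Rewind true,
                act2 t_in (None, MoveR) t_first (rd t_first, MoveL) rd)
        else (Decode ph (inord k.-1),
              act2 t_in (None, MoveR) t_first (digit E b, MoveR) rd)
      else (Done, idle rd)
  | Rewind b =>
      if rd (t_rewind b) is Some (inl d)
      then (Rewind b, act1 (t_rewind b) (rd (t_rewind b), MoveL) rd)
      else (if b then Run (start U) (start U) else Done,
            act1 (t_rewind b) (rd (t_rewind b), MoveR) rd)
  | Run s1 s2 =>
      if halting s1 && halting s2 then (Copy true, idle rd) else
      let n1 := next_state s1 (fun i => rd (Some (true, i))) in
      let n2 := next_state s2 (fun i => rd (Some (false, i))) in
      (Run n1.1 n2.1, fun j => match j with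
         | None => (rd None, Stay)
         | Some (b, i) => if b then n1.2 i else n2.2 i
         end)
  | Copy b =>
      if rd (t_result b) is Some (inl d)
      then (Copy b, act2 (t_result b) (rd (t_result b), MoveR)
                         t_out (digit E d, MoveR) rd)
      else if b then (Copy false, idle rd)
      else (Rewind false, act1 t_out (rd t_out, MoveL) rd)
  | Done => (Done, idle rd)
  end.

Definition is_done (p : phase) := if p is Done then true else false.

Definition concat_machine :=
  role_machine t_in t_out (Decode true ord0) is_done concat_trans.

Notation reach := (reach is_done concat_trans).
Implicit Types tau : track -> tape E.

Lemma update_idle tau :
  (fun j => update_tape (tau j) (idle (fun i => tau i 0) j)) = tau.
Proof. by apply/funext => j; rewrite update_stay. Qed.

(** The head has just moved left off [r] onto the first cell of [l]; it is on
    a blank when [l] is exhausted. *)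
Definition rewinding (l r : seq (cell E)) : tape E :=
  zipper (behead l) (head None l :: r).

Lemma reach_rewind b tau (x : seq bool) r :
  reach (Rewind b, tape_set tau (t_rewind b) (rewinding (map (@digit E) x) r))
    (if b then Run (start U) (start U) else Done,
     tape_set tau (t_rewind b) (zipper [::] (rev (map (@digit E) x) ++ r))).
Proof.
elim: x r => [|d x IH] r; apply: reach_step; rewrite /role_step /=.
  rewrite !tape_set_eq /= update_act1 tape_setK tape_set_eq update_right /=.
  rewrite -[[:: None]]/(rcons [::] None) zipper_blankl; exact: reach_refl.
rewrite !tape_set_eq /= update_act1 tape_setK tape_set_eq update_left /=.
by rewrite rev_cons cat_rcons; exact: IH.
Qed.

Lemma input_erase d (y : seq bool) :
  update_tape (input_tape E (d :: y)) (None, MoveR) = input_tape E y.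
Proof.
by rewrite !input_zipper update_right -[[:: None]]/(rcons [::] None) zipper_blankl.
Qed.

Definition decoding (y w : seq bool) : track -> tape E :=
  tape_set (tape_set (fun=> blank_tape E) t_first
    (zipper (map (@digit E) (rev w)) [::])) t_in (input_tape E y).

Lemma decodingE j y w : decoding y w j =
  if j == t_in then input_tape E y
  else if j == t_first then zipper (map (@digit E) (rev w)) [::]
  else blank_tape E.
Proof. by []. Qed.

Lemma decoding_erase d y w :
  tape_set (decoding (d :: y) w) t_in
    (update_tape (decoding (d :: y) w t_in) (None, MoveR)) = decoding y w.
Proof. by rewrite decodingE eqxx input_erase /decoding tape_setK. Qed.

Lemma decode_size ph y w c :
  reach (Decode ph (if ph then ord_max else inord 1), decoding y w) c ->
  reach (Decode ph ord0, decoding (true :: y) w) c.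
Proof.
move=> hr; apply: reach_step; rewrite /role_step /=.
by rewrite update_act1 decoding_erase.
Qed.

Lemma decode_switch y w c :
  reach (Decode false ord0, decoding y w) c ->
  reach (Decode true ord0, decoding (false :: y) w) c.
Proof.
move=> hr; apply: reach_step; rewrite /role_step /=.
by rewrite update_act1 decoding_erase.
Qed.

Lemma decode_bit ph k d y w c : k != ord0 ->
  reach (Decode ph (inord k.-1), decoding y (rcons w d)) c ->
  reach (Decode ph k, decoding (d :: y) w) c.
Proof.
move=> /negbTE k0 hr; apply: reach_step; rewrite /role_step /= k0.
rewrite update_act2 (tape_setC _ _ _ (isT : t_first != t_in)).
rewrite decoding_erase; move: hr; congr (reach (_, _) _).
rewrite /decoding [RHS]tape_setC // tape_setK; congr (tape_set (tape_set _ _ _) _ _).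
by rewrite [tape_set _ _ _ t_first]/(tape_set _ _ _ _) /tape_set /= update_right rev_rcons.
Qed.

Lemma decode_bits ph p (k : 'I_q.+2) y w c : size p = k :> nat ->
  reach (Decode ph ord0, decoding y (w ++ p)) c ->
  reach (Decode ph k, decoding (p ++ y) w) c.
Proof.
elim: p k w => [|d p IH] k w /= szp.
  by rewrite cats0; have -> : k = ord0 by apply/val_inj.
move=> hr; apply: decode_bit; first by rewrite -(inj_eq val_inj) /= -szp.
apply: IH; last by rewrite cat_rcons.
by rewrite inordK -szp //= szp ltnW.
Qed.

Definition running (c1 c2 : config U) (o : tape E) : track -> tape E := fun j =>
  match j with None => o | Some (b, i) => (if b then c1 else c2).2 i end.

Lemma decode_end y w :
  reach (Decode false ord0, decoding (false :: y) w)
    (Run (start U) (start U),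
     running (init_config U w) (init_config U y) (blank_tape E)).
Proof.
apply: reach_step; rewrite /role_step /=.
rewrite update_act2 (tape_setC _ _ _ (isT : t_first != t_in)) decoding_erase.
have := reach_rewind true (decoding y w) (rev w) [:: None].
congr (reach _ _); congr pair.
  by rewrite [t_rewind _]/t_first; congr tape_set; rewrite decodingE /= update_left.
rewrite -map_rev revK -[_ ++ _]/(_ ++ [:: None]) cats1 zipper_blankr -input_zipper.
apply/funext; case => [[[] i]|] //; rewrite /tape_set /decoding /running /=.
case: (eqVneq i ord0) => [->|ne]; first by rewrite eqxx.
have nf : (Some (true, i) == t_first) = false.
  by apply/eqP => -[/eqP]; rewrite (negbTE ne).
by rewrite /tape_set /= nf.
Qed.

Lemma next_stateE (c : config U) :
  step c = ((next_state c.1 (fun i => c.2 i 0)).1,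
            fun i => update_tape (c.2 i) ((next_state c.1 (fun i => c.2 i 0)).2 i)).
Proof.
rewrite /step /next_state; case: ifP => // _ /=.
rewrite [LHS]surjective_pairing; congr pair; apply/funext => i.
by rewrite update_stay.
Qed.

Lemma step_halted (c : config U) n : halting c.1 -> iter n (@step U) c = c.
Proof. by move=> hc; elim: n => //= n ->; rewrite /step hc. Qed.

(** A halted configuration is left unchanged by further steps, so the copy that
    halts first waits for the other. *)
Lemma reach_run n (c1 c2 : config U) o :
  let c1' := iter n (@step U) c1 in let c2' := iter n (@step U) c2 in
  halting c1'.1 -> halting c2'.1 ->
  reach (Run c1.1 c2.1, running c1 c2 o) (Copy true, running c1' c2' o).
Proof.
have stop (a b : config U) : halting a.1 -> halting b.1 ->
    reach (Run a.1 b.1, running a b o) (Copy true, running a b o).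
  move=> ha hb; apply: reach_step.
  rewrite /role_step /= ha hb /= update_idle; exact: reach_refl.
elim: n c1 c2 => [|n IH] c1 c2; first exact: stop.
move=> c1' c2' h1 h2.
case hh : (halting c1.1 && halting c2.1).
  case/andP: hh => ha hb; rewrite /c1' /c2' !step_halted //; exact: stop.
apply: reach_step; rewrite /role_step /= hh /=.
rewrite /c1' /c2' !iterSr in h1 h2 *.
have := IH (step c1) (step c2) h1 h2; congr (reach (_, _) _).
  by rewrite !next_stateE.
by apply/funext; case => [[[] i]|] /=; rewrite ?next_stateE // update_stay.
Qed.

Definition shift (t : tape E) (n : nat) : tape E := fun z => t (z + n%:Z).

Lemma update_shift t n : update_tape (shift t n) (t n%:Z, MoveR) = shift t n.+1.
Proof.
apply/funext => z.
have -> : update_tape (shift t n) (t n%:Z, MoveR) z =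
    if z + 1 == 0 then t n%:Z else shift t n (z + 1) by [].
rewrite /shift.
have -> : z + n.+1%:Z = z + 1 + n%:Z by lia.
by case: eqP => [->|//]; rewrite add0r.
Qed.

Lemma copy_word b (t : tape E) (x : seq bool) n l tau : tape_reads t x ->
  (n <= size x)%N -> tau (t_result b) = shift t n -> tau t_out = zipper l [::] ->
  exists tau', [/\ reach (Copy b, tau) (Copy b, tau'),
    tau' (t_result b) = shift t (size x),
    tau' (t_result (~~ b)) = tau (t_result (~~ b)) &
    tau' t_out = zipper (map (@digit E) (rev (drop n x)) ++ l) [::]].
Proof.
move=> [rx rend]; move: {2}(size x - n)%N (erefl (size x - n)%N) => m.
elim: m n l tau => [|m IH] n l tau szm nx tn tl.
  have -> : n = size x by lia.
  exists tau; split=> //; first exact: reach_refl.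
    by rewrite tn; congr shift; lia.
  by rewrite drop_size.
have nlt : (n < size x)%N by lia.
pose tau1 := tape_set (tape_set tau t_out
  (zipper (digit E (nth false x n) :: l) [::])) (t_result b) (shift t n.+1).
have [||||tau' [h1 h2 h3 h4]] := IH n.+1 (digit E (nth false x n) :: l) tau1.
- by lia.
- by [].
- by rewrite /tau1 tape_set_eq.
- by rewrite /tau1 /tape_set.
exists tau'; split => //.
- apply: reach_step; rewrite /role_step /= tn /shift add0r rx //=.
  rewrite update_act2 tl update_right /= tn -rx // update_shift.
  exact: h1.
- rewrite h3 /tau1 /tape_set.
  by case: (b).
- by rewrite h4 (drop_nth false nlt) rev_cons map_rcons cat_rcons.
Qed.

Lemma copy_end b (t : tape E) (x : seq bool) tau : tape_reads t x ->
  tau (t_result b) = shift t (size x) ->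
  reach (Copy b, tau)
    (if b then (Copy false, tau) else
       (Rewind false, tape_set tau t_out (update_tape (tau t_out) (tau t_out 0, MoveL)))).
Proof.
move=> [_ rend] tn; apply: reach_step; rewrite /role_step /= tn /shift add0r.
case e : (t (size x)) => [[d|d]|]; first by case: (rend d).
  all: case: b tn => tn; rewrite /= ?update_idle ?update_act1; exact: reach_refl.
Qed.

Lemma shift0 t : shift t 0 = t.
Proof. by apply/funext => z; rewrite /shift addr0. Qed.

Lemma concat_outputs p1 p2 x1 x2 code :
  (forall y c, reach (Decode false ord0, decoding (false :: y) p1) c ->
     reach (Decode true ord0, decoding (code ++ y) [::]) c) ->
  outputs U p1 x1 -> outputs U p2 x2 ->
  outputs concat_machine (code ++ p2) (x1 ++ x2).
Proof.
move=> dec [n1 [h1 r1]] [n2 [h2 r2]].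
set c1 := iter n1 _ _ in h1 r1; set c2 := iter n2 _ _ in h2 r2.
have e1 : iter (maxn n1 n2) (@step U) (init_config U p1) = c1.
  by rewrite -(subnK (leq_maxl n1 n2)) iterD step_halted.
have e2 : iter (maxn n1 n2) (@step U) (init_config U p2) = c2.
  by rewrite -(subnK (leq_maxr n1 n2)) iterD step_halted.
have run := @reach_run (maxn n1 n2) (init_config U p1) (init_config U p2) (blank_tape E).
rewrite /= e1 e2 in run; have {}run := run h1 h2.
set tau := running c1 c2 _ in run.
have [|||tau1 [k1 a1 a2 a3]] := @copy_word true (c1.2 ord_max) x1 0 [::] tau r1.
- by [].
- by rewrite shift0.
- by rewrite /tau /= blank_zipper.
have [|||tau2 [k2 b1 b2 b3]] := @copy_word false (c2.2 ord_max) x2 0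
   (map (@digit E) (rev x1)) tau1 r2.
- by [].
- by rewrite a2 shift0.
- by rewrite a3 drop0 cats0.
rewrite drop0 -map_cat -rev_cat in b3.
have k3 := copy_end r1 a1; have k4 := copy_end r2 b1.
have k5 := reach_rewind false tau2 (rev (x1 ++ x2)) [:: None].
have fin : reach (Decode true ord0, decoding (code ++ p2) [::])
    (Done, tape_set tau2 t_out (zipper [::] (map (@digit E) (x1 ++ x2)))).
  apply: dec; apply: reach_trans (decode_end _ _) _.
  apply: reach_trans run _; apply: reach_trans k1 _.
  apply: reach_trans k3 _; apply: reach_trans k2 _; apply: reach_trans k4 _.
  move: k5; rewrite -map_rev revK -[_ ++ [:: None]]/(_ ++ [:: None]) cats1 zipper_blankr.
  by rewrite b3 update_left.
apply: (@role_outputs _ _ _ _ _ _ _ _ _ _ _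
  (Done, tape_set tau2 t_out (zipper [::] (map (@digit E) (x1 ++ x2))))).
- by [].
- move: fin; congr (reach (_, _) _); rewrite /decoding; congr tape_set.
  by rewrite -blank_zipper tape_set_id.
- by [].
- by rewrite /= tape_set_eq; exact: zipper_reads.
Qed.

Lemma encode_pairs p : exists code, size code = (size p).*2.+1 /\
  forall y w c, reach (Decode false ord0, decoding (false :: y) (w ++ p)) c ->
     reach (Decode false ord0, decoding (code ++ y) w) c.
Proof.
elim: p => [|d p [code [sz dec]]].
  by exists [:: false]; split=> // y w c; rewrite cats0.
exists [:: true, d & code]; split; first by rewrite /= sz.
move=> y w c hr; rewrite !cat_cons; apply: decode_size.
apply: (@decode_bits false [:: d]); first by rewrite inordK.
by apply: dec; rewrite -catA.
Qed.

(** Only one bit per long chunk is wasted, whence a self-delimiting code whose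
    relative overhead is as small as desired. *)
Lemma encode_program p : exists code,
  (size code <= size p + size p %/ q.+1 + q.+2)%N /\
  forall y w c, reach (Decode false ord0, decoding (false :: y) (w ++ p)) c ->
     reach (Decode true ord0, decoding (code ++ y) w) c.
Proof.
have [n] := ubnP (size p); elim: n p => // n IH p szp.
have [small|large] := ltnP (size p) q.+1.
  have [code [sz dec]] := encode_pairs p.
  exists (false :: code); split; first by rewrite /= sz divn_small //; lia.
  by move=> y w c hr; apply: decode_switch; exact: dec.
have [|code [sz dec]] := IH (drop q.+1 p); first by rewrite size_drop; lia.
exists (true :: take q.+1 p ++ code); split.
  rewrite /= size_cat size_takel // (leq_ltn_trans (leq_add (leqnn _) sz)) //.
  have := divnMDl 1 (size p - q.+1) (ltn0Sn q); rewrite mul1n subnKC // => ->.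
  by rewrite size_drop; lia.
move=> y w c hr; rewrite cat_cons -catA; apply: decode_size.
apply: decode_bits; first by rewrite size_takel.
by apply: dec; rewrite -catA cat_take_drop.
Qed.

End Concat.

(** * Subadditivity of Kolmogorov complexity *)

Section Complexity.
Variables (U : turing_machine) (hU : universal U).

Definition copy_machine : turing_machine :=
  @TuringMachine unit void 0 tt xpredT (fun s rd => (s, fun i => (rd i, Stay))).

Lemma copy_outputs x : outputs copy_machine x x.
Proof.
exists 0%N; split => //; suff : tape_reads (input_tape void x) x by [].
rewrite input_zipper; exact: zipper_reads.
Qed.

(** A universal machine simulates the machine that halts at once, whose output
    is its input. *)
Lemma program_exists : exists c, forall x, exists2 p, outputs U p x & size p = (size x + c)%N.
Proof.
have [e he] := hU copy_machine; exists (size e) => x; exists (e ++ x).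
  by apply/he; exact: copy_outputs.
by rewrite size_cat addnC.
Qed.

(** Every word has a program, so the minimum in the definition of the
    complexity is attained. *)
Lemma kolmogorovP x :
  (exists2 p, outputs U p x & size p = kolmogorov U x) /\
  (forall p, outputs U p x -> (kolmogorov U x <= size p)%N).
Proof.
suff : [set n : nat | (exists2 y, outputs U y x & size y = n) /\
    (forall y, outputs U y x -> (n <= size y)%N)] (kolmogorov U x) by [].
rewrite /kolmogorov; apply: xgetPex.
have [c hc] := program_exists; have [p hp _] := hc x.
pose Q n := `[< exists2 y, outputs U y x & size y = n >].
have exQ : exists n, Q n by exists (size p); apply/asboolP; exists p.
exists (ex_minn exQ); case: ex_minnP => m /asboolP hm min; split=> // y hy.
by apply: min; apply/asboolP; exists y.
Qed.

Lemma kolmogorov_size : exists c, forall x, (kolmogorov U x <= size x + c)%N.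
Proof.
have [c hc] := program_exists; exists c => x; have [p hp <-] := hc x.
by apply: (kolmogorovP x).2.
Qed.

Lemma kolmogorov_cat q : exists c, forall x1 x2,
  (kolmogorov U (x1 ++ x2) <= kolmogorov U x1 + kolmogorov U x1 %/ q.+1 +
     kolmogorov U x2 + c)%N.
Proof.
have [e he] := hU (concat_machine U q).
exists (size e + q.+2)%N => x1 x2.
have [[p1 o1 s1] _] := kolmogorovP x1; have [[p2 o2 s2] _] := kolmogorovP x2.
have [code [sz dec]] := encode_program U q p1.
have /he o := concat_outputs (fun y => @dec y [::]) o1 o2.
apply: leq_trans ((kolmogorovP _).2 _ o) _.
by rewrite -s1 -s2 !size_cat; lia.
Qed.

End Complexity.

(** * Disjoint intervals and their growth *)

Section Packing.
Variable R : realFieldType.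
Implicit Types (a b : nat -> nat) (p e n : nat) (S : seq nat) (eps tau : R).

(** The intervals $[m, m + a_m)$, for [m] in [S], are disjoint, listed from left
    to right, and contained in $[p, e)$. *)
Fixpoint packed a p S e : bool :=
  if S is m :: S' then (p <= m)%N && packed a (m + a m) S' e else (p <= e)%N.

Lemma packed_weaken a p' p S e : (p' <= p)%N -> packed a p S e -> packed a p' S e.
Proof.
case: S => [|m S] /= pp; first exact: leq_trans.
by case/andP=> pm ->; rewrite (leq_trans pp).
Qed.

Lemma packed_le a p S e : packed a p S e -> (p <= e)%N.
Proof.
elim: S p => //= m S IH p /andP[pm /IH h].
by rewrite (leq_trans pm) // (leq_trans (leq_addr _ _) h).
Qed.

Lemma packed_mem a p S e m :
  packed a p S e -> m \in S -> (p <= m)%N /\ (m + a m <= e)%N.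
Proof.
elim: S p => //= h S IH p /andP[ph pk]; rewrite inE => /orP[/eqP->|mS].
  by split=> //; exact: packed_le pk.
by have [h1 h2] := IH _ pk mS; split=> //; lia.
Qed.

Lemma packed_lt a p S e m n :
  packed a p S e -> m \in S -> n \in S -> (m < n)%N -> (m + a m <= n)%N.
Proof.
elim: S p => //= h S IH p /andP[ph pk]; rewrite !inE.
move=> /orP[/eqP->|mS] /orP[/eqP->|nS] mn.
- by rewrite ltnn in mn.
- by have [] := packed_mem pk nS.
- by have [] := packed_mem pk mS; lia.
- exact: IH pk mS nS mn.
Qed.

Lemma packed_filter (Q : pred nat) a p S e n e' :
  packed a p S e -> (n <= e')%N ->
  (forall m, m \in S -> Q m -> (n <= m)%N /\ (m + a m <= e')%N) ->
  packed a n [seq m <- S | Q m] e'.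
Proof.
elim: S p n => //= h S IH p n /andP[ph pk] ne hQ; case: ifP => Qh; last first.
  by apply: IH pk ne _ => m mS; apply: hQ; rewrite inE mS orbT.
have [nh he] := hQ h (mem_head _ _) Qh; rewrite /= nh /=.
apply: IH (pk) he _ => m mS Qm; have [_ he'] := hQ m (@mem_behead _ (h :: S) _ mS) Qm.
by split=> //; have [] := packed_mem pk mS.
Qed.

Lemma packed_sum a p S e :
  packed a p S e -> p%:R + \sum_(m <- S) (a m)%:R <= e%:R :> R.
Proof.
elim: S p => /= [|m S IH] p; first by rewrite big_nil addr0 ler_nat.
case/andP=> pm /IH; rewrite big_cons natrD; apply: le_trans.
by rewrite addrA !lerD2r ler_nat.
Qed.

(** At most one interval of a disjoint family straddles a given point. *)
Lemma packed_overrun a p S e x (B : R) : packed a p S e -> 0 <= B ->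
  (forall m, m \in S -> (m < x < m + a m)%N -> (a m)%:R <= B) ->
  \sum_(m <- S | (m < x < m + a m)%N) (a m)%:R <= B.
Proof.
elim: S p => [|h S IH] p pk B0 hB; first by rewrite big_nil.
move: pk => /= /andP[ph pk]; rewrite big_cons; case: ifP => hx; last first.
  by apply: IH pk B0 _ => m mS; apply: hB; rewrite inE mS orbT.
rewrite big_seq_cond big1 ?addr0; first by apply: hB hx; rewrite mem_head.
by move=> m /andP[mS mx]; have [] := packed_mem pk mS; lia.
Qed.

(** The ratio of lengths [(1 + eps) / eps ^+ 2] is what lets the losses in the
    greedy selection below add up to a proportion [eps]. *)
Definition outgrows eps a b m := (1 + eps) * (a m)%:R <= eps ^+ 2 * (b m)%:R.

(** Greedy selection from left to right of intervals of lengths [b].  If some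
    interval of length [a] starting inside the current candidate is longer than
    [eps] times the candidate, the candidate is dropped and the selection jumps
    to the start of that interval, whose own candidate is much longer.  The
    total [a]-length skipped is at most the distance jumped, thus at most the
    length of the dropped candidate, and these lengths increase geometrically
    along consecutive jumps: the whole loss is paid by [eps] times the candidate
    that is finally kept.  The term for the head of [S] is the credit that
    carries this payment through the induction. *)
Lemma jump_cover eps a b S p e : 0 < eps -> packed a p S e ->
  (forall m, m \in S -> outgrows eps a b m) ->
  (forall m, m \in S -> (0 < b m)%N) ->
  (forall m, m \in S -> (m + b m <= e)%N) ->
  exists S' : seq nat, [/\ {subset S' <= S}, packed b p S' e,
    forall n m, n \in S' -> m \in S -> (n <= m < n + b n)%N ->
      (a m)%:R <= eps * (b n)%:R
  & \sum_(m <- S) (a m)%:R + (if S is h :: _ then eps * (b h)%:R else 0) <=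
    \sum_(n <- S') (\sum_(m <- S | (n <= m < n + b n)%N) (a m)%:R + eps * (b n)%:R)].
Proof.
move=> eps0; have [k] := ubnP (size S); elim: k S p => // k IH S p szS pk ab bpos be.
case: S szS pk ab bpos be => [|h S0] szS pk ab bpos be.
  by exists [::]; split=> //; rewrite !big_nil addr0.
set S := h :: S0 in szS pk ab bpos be *.
have hS : h \in S by rewrite mem_head.
have [ph hae] := packed_mem pk hS.
have pkh : packed a h S e by move: pk; rewrite /= leqnn => /andP[].
have leh m : m \in S -> (h <= m)%N by move=> /(packed_mem pkh)[].
have sub_cut c : (h < c <= e)%N -> let S1 := [seq m <- S | (c <= m)%N] in
    [/\ (size S1 < k)%N, {subset S1 <= S}, packed a c S1 e,
     \sum_(m <- S) (a m)%:R = \sum_(m <- S | (m < c)%N) (a m)%:R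
        + \sum_(m <- S1) (a m)%:R :> R &
     forall n, (c <= n)%N ->
       \sum_(m <- S1 | (n <= m < n + b n)%N) (a m)%:R =
       \sum_(m <- S | (n <= m < n + b n)%N) (a m)%:R :> R].
  move=> /andP[hc ce] S1; split.
  - rewrite /S1 /S /= (leqNgt c h) hc /= size_filter; move: szS => /=.
    by have := count_size (fun m => c <= m)%N S0; lia.
  - by move=> m; rewrite mem_filter => /andP[].
  - apply: packed_filter (pk) ce _ => m mS cm; split=> //.
    by have [] := packed_mem pk mS.
  - rewrite /S1 big_filter (bigID (fun m => (m < c)%N)) /=; congr (_ + _).
    by apply: eq_bigl => m; rewrite -leqNgt.
  - move=> n cn; rewrite /S1 big_filter_cond; apply: eq_bigl => m.
    by case: (leqP n m) => nm; rewrite ?andbF // (leq_trans cn nm).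
have b0 := bpos h hS.
case: (boolP (has (fun m => (m < h + b h)%N && (eps * (b h)%:R < (a m)%:R)) S)).
(* The candidate at [h] is dropped in favour of the one at [n]. *)
- move=> /hasP[n nS /andP[nlt big]].
  have hn : (h < n)%N.
    rewrite ltn_neqAle (leh _ nS) andbT; apply/eqP => hnE; move: big; rewrite -hnE.
    have := ab h hS; rewrite /outgrows => f1 f2.
    have : (1 + eps) * (eps * (b h)%:R) < (1 + eps) * (a h)%:R.
      by rewrite ltr_pM2l // addr_gt0.
    have : 0 <= eps * (b h)%:R by rewrite mulr_ge0 // ltW.
    lra.
  have ne : (h < n <= e)%N by rewrite hn /=; have [] := packed_mem pk nS; lia.
  have [szS1 subS1 pkS1 sumS1 gainS1] := sub_cut n ne.
  set S1 := [seq _ <- _ | _] in szS1 subS1 pkS1 sumS1 gainS1.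
  have [|||S' [sub' pk' good' sum']] := IH S1 n szS1 pkS1.
  + by move=> m /subS1; exact: ab.
  + by move=> m /subS1; exact: bpos.
  + by move=> m /subS1; exact: be.
  have nS1 : n \in S1 by rewrite mem_filter leqnn.
  have nS' m : m \in S' -> (n <= m)%N by move=> /(packed_mem pk')[].
  exists S'; split.
  + by move=> m /sub' /subS1.
  + exact: packed_weaken (leq_trans ph (ltnW hn)) pk'.
  + move=> m m' mS' m'S mm'; apply: good' => //.
    by rewrite mem_filter m'S andbT (leq_trans (nS' _ mS') (andP mm').1).
  rewrite sumS1.
  have -> : \sum_(n0 <- S') (\sum_(m <- S | (n0 <= m < n0 + b n0)%N) (a m)%:R + eps * (b n0)%:R)
     = \sum_(n0 <- S') (\sum_(m <- S1 | (n0 <= m < n0 + b n0)%N) (a m)%:R + eps * (b n0)%:R).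
    by rewrite big_seq [RHS]big_seq; apply: eq_bigr => m /nS' /gainS1 ->.
  apply: le_trans sum'.
  have head1 : (if S1 is h1 :: _ then eps * (b h1)%:R else 0) = eps * (b n)%:R.
    case E : S1 nS1 pkS1 => [|h1 S2] //; rewrite inE => nS2 pkS1.
    have [h1n _] := packed_mem pkS1 (mem_head _ _).
    suff -> : h1 = n by [].
    apply/eqP; rewrite eqn_leq h1n andbT.
    case/orP: nS2 => [/eqP->//|nS2]; move: pkS1 => /= /andP[_ pk2].
    by have [h1n' _] := packed_mem pk2 nS2; exact: leq_trans (leq_addr _ _) h1n'.
  rewrite head1.
  have low : \sum_(m <- S | (m < n)%N) (a m)%:R <= (b h)%:R :> R.
    have := @packed_sum a h [seq m <- S | (m < n)%N] n; rewrite big_filter => hsum.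
    have : h%:R + \sum_(m <- S | (m < n)%N) (a m)%:R <= n%:R :> R.
      apply: hsum; apply: packed_filter (pk) (ltnW hn) _ => m mS mn.
      by split; [exact: leh|exact: packed_lt pk mS nS mn].
    have : n%:R <= h%:R + (b h)%:R :> R by rewrite -natrD ler_nat ltnW.
    lra.
  have abn := ab n nS; rewrite /outgrows in abn.
  have : (1 + eps) * (b h)%:R <= eps * (b n)%:R.
    have bigM : (1 + eps) * (eps * (b h)%:R) <= (1 + eps) * (a n)%:R.
      by rewrite ler_pM2l ?ltW // addr_gt0.
    rewrite -(ler_pM2l eps0); lra.
  rewrite /=; lra.
(* The candidate at [h] is kept, and the selection resumes at its end. *)
- move=> /hasPn good.
  have cutP : (h < h + b h <= e)%N by rewrite be // andbT; lia.
  have [szS1 subS1 pkS1 sumS1 gainS1] := sub_cut _ cutP.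
  set S1 := [seq _ <- _ | _] in szS1 subS1 pkS1 sumS1 gainS1.
  have [|||S' [sub' pk' good' sum']] := IH S1 _ szS1 pkS1.
  + by move=> m /subS1; exact: ab.
  + by move=> m /subS1; exact: bpos.
  + by move=> m /subS1; exact: be.
  have nS' m : m \in S' -> (h + b h <= m)%N by move=> /(packed_mem pk')[].
  exists (h :: S'); split.
  + by move=> m; rewrite inE => /orP[/eqP->//|/sub' /subS1].
  + by rewrite /= ph.
  + move=> m m'; rewrite inE => /orP[/eqP->|mS'] m'S mm'.
      by have := good _ m'S; rewrite (andP mm').2 /= -leNgt.
    apply: good' => //.
    by rewrite mem_filter m'S andbT (leq_trans (nS' _ mS') (andP mm').1).
  rewrite sumS1 [leRHS]big_cons.
  have -> : \sum_(n0 <- S') (\sum_(m <- S | (n0 <= m < n0 + b n0)%N) (a m)%:R + eps * (b n0)%:R)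
     = \sum_(n0 <- S') (\sum_(m <- S1 | (n0 <= m < n0 + b n0)%N) (a m)%:R + eps * (b n0)%:R).
    by rewrite big_seq [RHS]big_seq; apply: eq_bigr => m /nS' /gainS1 ->.
  have -> : \sum_(m <- S | (m < h + b h)%N) (a m)%:R =
            \sum_(m <- S | (h <= m < h + b h)%N) (a m)%:R :> R.
    rewrite big_seq_cond [RHS]big_seq_cond; apply: eq_bigl => m.
    by case: (boolP (m \in S)) => // /leh ->.
  have : \sum_(m <- S1) (a m)%:R + 0 <= \sum_(m <- S1) (a m)%:R +
     (if S1 is h1 :: _ then eps * (b h1)%:R else 0).
    by rewrite lerD2l; case: (S1) => // h1 _; rewrite mulr_ge0 // ltW.
  move=> /le_trans/(_ sum'); rewrite addr0 /=; lra.
Qed.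

(** In a selected interval, the previous ones are either contained in it, or
    straddle its right end; the latter is a single short interval. *)
Lemma packed_growth eps tau a b S p e : 0 < eps -> packed a p S e ->
  (forall m, m \in S -> outgrows eps a b m) ->
  (forall m, m \in S -> (0 < b m)%N) ->
  (forall m, m \in S -> (m + b m <= e)%N) ->
  (forall n, n \in S ->
    \sum_(m <- S | (n <= m)%N && (m + a m <= n + b n)%N) (a m)%:R <= tau * (b n)%:R) ->
  exists S' : seq nat, [/\ {subset S' <= S}, packed b p S' e &
    \sum_(m <- S) (a m)%:R <= (tau + 2 * eps) * \sum_(n <- S') (b n)%:R].
Proof.
move=> eps0 pk ab bpos be contained.
have [S' [sub pk' good sum]] := jump_cover eps0 pk ab bpos be.
exists S'; split=> //.
apply: (@le_trans _ _ (\sum_(m <- S) (a m)%:R + (if S is h :: _ then eps * (b h)%:R else 0))).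
  by rewrite lerDl; case: (S) => // h _; rewrite mulr_ge0 // ltW.
apply: le_trans sum _; rewrite mulr_sumr big_seq [leRHS]big_seq.
apply: ler_sum => n nS'; have nS := sub _ nS'.
rewrite (bigID (fun m => (m + a m <= n + b n)%N)) /=.
have inside : \sum_(m <- S | (n <= m < n + b n)%N && (m + a m <= n + b n)%N)
    (a m)%:R <= tau * (b n)%:R.
  apply: le_trans (contained n nS); rewrite [leRHS](bigID (fun m => m < n + b n)%N) /=.
  rewrite -[leLHS]addr0 lerD ?sumr_ge0 //.
  by rewrite le_eqVlt; apply/orP; left; apply/eqP; apply: eq_bigl => m; rewrite andbAC.
have over : \sum_(m <- S | (n <= m < n + b n)%N && ~~ (m + a m <= n + b n)%N)
    (a m)%:R <= eps * (b n)%:R.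
  have [_ nbe] := packed_mem pk' nS'.
  have pk2 : packed a n [seq m <- S | (n <= m)%N] e.
    apply: packed_filter (pk) _ _ => [|m mS nm]; first by lia.
    by split=> //; have [] := packed_mem pk mS.
  have := @packed_overrun a n _ e (n + b n) (eps * (b n)%:R) pk2.
  rewrite big_filter_cond => h; apply: le_trans (h _ _).
  - rewrite le_eqVlt; apply/orP; left; apply/eqP; apply: eq_bigl => m.
    by rewrite -ltnNge andbA.
  - by rewrite mulr_ge0 // ltW.
  - move=> m; rewrite mem_filter => /andP[nm mS] /andP[mlt _].
    by apply: good; rewrite ?nm.
lra.
Qed.
End Packing.

Lemma growth_ge0 (R : realFieldType) (eps delta : R) : 0 < eps -> delta <= 1 ->
  0 <= 1 + 2 * eps /\ 0 <= 1 - delta + 2 * eps.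
Proof. by move=> *; split; lra. Qed.

(** Levels alternate: [lo l] is followed by [hi l.+1], and then by [lo l.+1].
    The only source of growth is [hi_unfilled]. *)
Section Tower.
Variables (R : realFieldType) (eps delta : R) (lo hi : nat -> nat -> nat).
Variables (A : seq nat) (E K : nat).
Hypotheses (eps0 : 0 < eps) (delta1 : delta <= 1).
Hypothesis packed_hi0 : packed (hi 0%N) 0%N A E.
Hypothesis lo_gt : forall l n, (l < K)%N -> n \in A -> outgrows eps (hi l) (lo l) n.
Hypothesis hi_gt : forall l n, (l < K)%N -> n \in A ->
  outgrows eps (lo l) (hi l.+1) n.
Hypothesis lo_pos : forall l n, (l < K)%N -> n \in A -> (0 < lo l n)%N.
Hypothesis hi_pos : forall l n, (l < K)%N -> n \in A -> (0 < hi l.+1 n)%N.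
Hypothesis lo_end : forall l n, (l < K)%N -> n \in A -> (n + lo l n <= E)%N.
Hypothesis hi_end : forall l n, (l < K)%N -> n \in A -> (n + hi l.+1 n <= E)%N.
Hypothesis hi_unfilled : forall l n S, (l < K)%N -> n \in A -> {subset S <= A} ->
  packed (lo l) n S (n + hi l.+1 n) ->
  \sum_(m <- S) (lo l m)%:R <= (1 - delta) * (hi l.+1 n)%:R :> R.

Let contained_sum a b n S (tau : R) : packed a 0 S E ->
  (forall S1, {subset S1 <= S} -> packed a n S1 (n + b n) ->
     \sum_(m <- S1) (a m)%:R <= tau * (b n)%:R) ->
  \sum_(m <- S | (n <= m)%N && (m + a m <= n + b n)%N) (a m)%:R <= tau * (b n)%:R.
Proof.
move=> pk h; rewrite -big_filter; apply: h.
  by move=> m; rewrite mem_filter => /andP[].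
by apply: packed_filter pk (leq_addr _ _) _ => m _ /andP[].
Qed.

(** Passing from [hi l] to [lo l] costs at most a factor [1 + 2 * eps], since
    disjoint intervals cannot exceed the interval that contains them; passing
    from [lo l] to [hi l.+1] gains the factor of [hi_unfilled]. *)
Lemma packed_tower :
  \sum_(n <- A) (hi 0%N n)%:R <=
  ((1 + 2 * eps) * (1 - delta + 2 * eps)) ^+ K * E%:R :> R.
Proof.
set g := (1 + _) * _; have g0 : 0 <= g.
  by have [h1 h2] := growth_ge0 eps0 delta1; exact: mulr_ge0.
suff [S [sub pk sum]] : exists S : seq nat, [/\ {subset S <= A},
    packed (hi K) 0%N S E &
    \sum_(n <- A) (hi 0%N n)%:R <= g ^+ K * \sum_(n <- S) (hi K n)%:R].
  apply: le_trans sum _; apply: ler_wpM2l; first exact: exprn_ge0.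
  by have := packed_sum R pk; rewrite add0r.
have := leqnn K; move: {1 3 4 5}K => l; elim: l => [|l IH] lK.
  by exists A; split=> //; rewrite expr0 mul1r.
have [S [sub pk sum]] := IH (ltnW lK).
have [||||S1 [sub1 pk1 sum1]] := @packed_growth _ eps 1 (hi l) (lo l) S 0 E eps0 pk.
- by move=> m /sub; exact: lo_gt.
- by move=> m /sub; exact: lo_pos.
- by move=> m /sub; exact: lo_end.
- move=> n nS; apply: contained_sum pk _ => S1 _ pk1; rewrite mul1r.
  by have := packed_sum R pk1; rewrite natrD lerD2l.
have [||||S2 [sub2 pk2 sum2]] :=
  @packed_growth _ eps (1 - delta) (lo l) (hi l.+1) S1 0 E eps0 pk1.
- by move=> m /sub1 /sub; exact: hi_gt.
- by move=> m /sub1 /sub; exact: hi_pos.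
- by move=> m /sub1 /sub; exact: hi_end.
- move=> n /sub1 /sub nA; apply: contained_sum pk1 _ => S2 sub2 pk2.
  by apply: hi_unfilled => // m /sub2 /sub1 /sub.
exists S2; split=> //; first by move=> m /sub2 /sub1 /sub.
apply: le_trans sum _; rewrite exprSr -mulrA; apply: ler_wpM2l; first exact: exprn_ge0.
apply: le_trans sum1 _; rewrite /g -mulrA; apply: ler_wpM2l => //.
exact: (growth_ge0 eps0 delta1).1.
Qed.
End Tower.

(** * High words are not filled by low words *)

Section Words.
Implicit Types (x : nat -> bool).

Definition word x n l : seq bool := mkseq (fun i => x (n + i)%N) l.

Lemma size_word x n l : size (word x n l) = l.
Proof. exact: size_mkseq. Qed.

Lemma word_cat x n l1 l2 : word x n (l1 + l2) = word x n l1 ++ word x (n + l1) l2.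
Proof.
rewrite /word /mkseq iotaD map_cat add0n; congr cat.
rewrite -[in iota l1 _](addn0 l1) iotaDl -map_comp.
by apply: eq_map => i /=; rewrite addnA.
Qed.

End Words.

Section LowFill.
Variables (U : turing_machine) (hU : universal U) (R : realType) (s t : R).
Hypothesis hst : s < t.
Local Notation kappa := (kolmogorov U).

Lemma kolmogorov_subadditive (theta : R) : 0 < theta -> exists c : nat, forall x1 x2,
  (kappa (x1 ++ x2))%:R <= (1 + theta) * (kappa x1)%:R + (kappa x2)%:R + c%:R :> R.
Proof.
move=> th0; pose q := Num.bound theta^-1.
have [c hc] := kolmogorov_cat hU q; exists c => x1 x2.
have := hc x1 x2; rewrite -(ler_nat R) !natrD => /le_trans; apply.
rewrite !lerD2r mulrDl mul1r lerD2l.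
have qth : theta^-1 <= q.+1%:R.
  apply: le_trans (ltW (archi_boundP _)) _; first by rewrite invr_ge0 ltW.
  by rewrite ler_nat leqnSn.
have := leq_divM (kappa x1) q.+1; rewrite -(ler_nat R) natrM => h.
apply: le_trans (ler_wpM2l (ltW th0) h).
rewrite mulrCA ler_peMr //.
by rewrite -ler_pdivrMl // mulr1.
Qed.

(** Concatenate, from left to right, literal descriptions of the gaps and
    optimal descriptions of the blocks.  The factor 2 for the gaps absorbs the
    overhead [theta <= 1]; the constant paid for each gap is charged to the
    block that follows it. *)
Lemma kolmogorov_blocks theta : 0 < theta <= 1 -> exists c : nat,
  forall x a S p e, packed a p S e ->
  (kappa (word x p (e - p)))%:R <=
    2 * ((e - p)%:R - \sum_(m <- S) (a m)%:R) +
    \sum_(m <- S) ((1 + theta) * (kappa (word x m (a m)))%:R + c%:R) + c%:R :> R.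
Proof.
move=> /andP[th0 th1]; have [c0 hc0] := kolmogorov_size hU.
have [c hc] := kolmogorov_subadditive th0.
have plain x n l : (kappa (word x n l))%:R <= l%:R + c0%:R :> R.
  by rewrite -natrD ler_nat -{2}(size_word x n l).
have [B BE] : exists B : nat, B%:R = 2 * (c0%:R + c%:R) :> R.
  by exists (2 * (c0 + c))%N; rewrite natrM natrD.
exists B => x a S p e; elim: S p => [|m S IH] p pk.
  rewrite !big_nil addr0 subr0; apply: le_trans (plain _ _ _) _.
  rewrite BE; have := ler0n R (e - p); have := ler0n R c; have := ler0n R c0; lra.
move: pk => /= /andP[pm pk]; have me := packed_le pk.
have -> : (e - p = (m - p) + (a m + (e - (m + a m))))%N by lia.
rewrite word_cat subnKC // word_cat.
have h1 := hc (word x p (m - p)) (word x m (a m) ++ word x (m + a m) (e - (m + a m))).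
have h2 := hc (word x m (a m)) (word x (m + a m) (e - (m + a m))).
have h3 := IH _ pk; have h4 := plain x p (m - p)%N.
rewrite !big_cons !natrD BE in h3 *.
have h5 : (1 + theta) * (kappa (word x p (m - p)))%:R <= 2 * (kappa (word x p (m - p)))%:R.
  by apply: ler_wpM2r => //; lra.
lra.
Qed.

(** If low blocks of length at least [L] covered more than a proportion
    [1 - delta] of a word, their descriptions would cost little more than [s]
    per letter, the overheads being negligible for large [L], and the gaps at
    most [2 * delta] per letter: altogether less than [t]. *)
Lemma high_unfilled : exists delta : R, exists L : nat, 0 < delta <= 1 / 2 /\
  forall x a S n l, t * l%:R < (kappa (word x n l))%:R ->
    packed a n S (n + l) ->
    (forall m, m \in S -> (L <= a m)%N /\ (kappa (word x m (a m)))%:R <= s * (a m)%:R) ->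
    \sum_(m <- S) (a m)%:R <= (1 - delta) * l%:R.
Proof.
pose sigma := t - s; have sg0 : 0 < sigma by rewrite subr_gt0.
(* The gap [sigma] between the two rates has to pay for the overhead [theta],
   for the constants [c], and for the uncovered letters. *)
pose theta := Num.min 1 (sigma / (4 * (1 + `|s|))).
have den0 : 0 < 4 * (1 + `|s|) by rewrite mulr_gt0 // ltr_pwDl.
have th : 0 < theta <= 1 by rewrite lt_min ltr01 divr_gt0 // ge_min lexx.
have thE : theta * `|s| <= sigma / 4.
  have : theta <= sigma / (4 * (1 + `|s|)) by rewrite ge_min lexx orbT.
  rewrite ler_pdivlMr // => h; rewrite ler_pdivlMr //.
  have := ltW (andP th).1; have := normr_ge0 s; nra.
have [c hc] := kolmogorov_blocks th.
pose delta := Num.min (1 / 2) (sigma / 4).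
pose L := (Num.bound (8 * c%:R / sigma)).+1.
have Lc : c%:R <= sigma / 8 * L%:R.
  have : 8 * c%:R / sigma <= L%:R.
    apply: le_trans (ltW (archi_boundP _)) _; last by rewrite ler_nat.
    by rewrite divr_ge0 ?mulr_ge0 // ltW.
  rewrite ler_pdivrMr //; lra.
exists delta, L; split.
  by rewrite lt_min ge_min lexx !divr_gt0.
move=> x a S n l high pk low; rewrite leNgt; apply/negP => full.
have := hc x a S n (n + l)%N pk; rewrite addKn => hk.
have sumle : \sum_(m <- S) (a m)%:R <= l%:R :> R.
  by have := packed_sum R pk; rewrite natrD lerD2l.
have del1 : delta <= 1 / 2 by rewrite ge_min lexx.
have del2 : delta <= sigma / 4 by rewrite ge_min lexx orbT.
have del0 : 0 < delta by rewrite lt_min !divr_gt0.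
have sum0 : 0 < \sum_(m <- S) (a m)%:R :> R.
  by apply: le_lt_trans full; rewrite mulr_ge0 //; lra.
have sumL : L%:R <= \sum_(m <- S) (a m)%:R :> R.
  case: (S) sum0 low => [|m S']; first by rewrite big_nil ltxx.
  move=> _ /(_ m (mem_head _ _))[Lm _]; rewrite big_cons -[leLHS]addr0 lerD ?ler_nat //.
  by rewrite sumr_ge0.
have blocks : \sum_(m <- S) ((1 + theta) * (kappa (word x m (a m)))%:R + c%:R) <=
    (s + 3 * sigma / 8) * \sum_(m <- S) (a m)%:R.
  rewrite mulr_sumr big_seq [leRHS]big_seq; apply: ler_sum => m mS.
  have [Lm lowm] := low m mS.
  have Lm' : L%:R <= (a m)%:R :> R by rewrite ler_nat.
  have h1 : (1 + theta) * (kappa (word x m (a m)))%:R <= (1 + theta) * (s * (a m)%:R).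
    by rewrite ler_wpM2l // addr_ge0 // ltW // (andP th).1.
  have h2 : theta * s * (a m)%:R <= sigma / 4 * (a m)%:R.
    rewrite ler_wpM2r //; apply: le_trans thE; rewrite ler_wpM2l ?ler_norm //.
    by rewrite ltW // (andP th).1.
  have h3 : sigma / 8 * L%:R <= sigma / 8 * (a m)%:R by rewrite ler_wpM2l // divr_ge0 // ltW.
  lra.
have s0 : 0 <= s.
  case: (S) sum0 low => [|m S']; first by rewrite big_nil ltxx.
  move=> _ /(_ m (mem_head _ _))[Lm lowm].
  have am0 : 0 < (a m)%:R :> R by rewrite ltr0n (leq_trans _ Lm).
  by rewrite -(pmulr_lge0 _ am0) (le_trans _ lowm).
have blocks' : (s + 3 * sigma / 8) * \sum_(m <- S) (a m)%:R <= (s + 3 * sigma / 8) * l%:R.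
  by apply: ler_wpM2l => //; lra.
have filler : delta * l%:R <= sigma / 4 * l%:R by rewrite ler_wpM2r.
have : sigma / 8 * L%:R <= sigma / 8 * l%:R.
  by apply: ler_wpM2l (le_trans sumL sumle); rewrite divr_ge0 // ltW.
have tE : t = s + sigma by rewrite /sigma; lra.
move: high; rewrite tE => high.
lra.
Qed.
End LowFill.

(** * Starting points of many upcrossings are rare *)

Lemma exists_expr_le (R : realType) (x e : R) : 0 <= x < 1 -> 0 < e ->
  exists r, x ^+ r <= e.
Proof.
move=> /andP[x0 x1] e0; have : `|x| < 1 by rewrite ger0_norm.
move=> /cvg_expr /cvgrPdist_lt /(_ e e0)[r _ /(_ r (leqnn r))] /=.
rewrite sub0r normrN ger0_norm ?exprn_ge0 // => /ltW h.
by exists r.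
Qed.

Section Crossings.
Variables (R : realFieldType) (i j : nat -> nat) (k : nat).
Hypothesis i0 : (1 <= i 0)%N.
Hypothesis ij : forall m, (m < k)%N -> (i m < j m)%N.
Hypothesis ji : forall m, (m.+1 < k)%N -> (j m < i m.+1)%N.

Lemma crossing_index m : (m < k)%N -> (m < i m)%N.
Proof.
elim: m => // m IH mk; have := IH (ltnW mk); have := ij (ltnW mk).
by have := ji mk; lia.
Qed.

(** If each low word is at most [theta] times the next high word, lengths are
    multiplied by [theta^-1] at each upcrossing. *)
Lemma crossing_growth (theta : R) L r m : 0 <= theta ->
  (forall m, (L <= m < k)%N -> (i m)%:R <= theta * (j m)%:R) ->
  (L <= m)%N -> (m + r < k)%N -> (i m)%:R <= theta ^+ r * (i (m + r))%:R.
Proof.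
move=> th0 grow Lm; elim: r => [|r IH] mrk; first by rewrite addn0 mul1r.
rewrite addnS in mrk *; have mk := ltnW mrk.
apply: le_trans (IH mk) _.
rewrite exprSr -mulrA; apply: ler_wpM2l; first exact: exprn_ge0.
apply: le_trans (grow (m + r)%N _) _; first by rewrite (leq_trans Lm (leq_addr _ _)).
by rewrite ler_wpM2l // ler_nat ltnW // ji.
Qed.
End Crossings.

Section Count.
Variables (U : turing_machine) (hU : universal U) (R : realType) (s t : R).
Hypothesis hst : s < t.
Local Notation kappa := (kolmogorov U).

Definition rate (x : nat -> bool) n l : R := (kappa (word x n l))%:R / l%:R.

Definition upcrosses_before (x : nat -> bool) n k M : Prop :=
  exists i j : nat -> nat,
    [/\ (1 <= i 0)%N,
        forall m, (m < k)%N -> (i m < j m)%N,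
        forall m, (m.+1 < k)%N -> (j m < i m.+1)%N,
        forall m, (m < k)%N -> rate x n (i m) < s /\ t < rate x n (j m)
      & forall m, (m < k)%N -> (j m <= M)%N].

Lemma packed_iota p N : packed (fun=> 1%N) p (iota p N) (p + N).
Proof. by elim: N p => [|N IH] p /=; rewrite ?addn0 // leqnn addn1 addnS -addSn IH. Qed.

(** The first [L] upcrossings are dropped, so that low words are long enough
    for [high_unfilled]; then one low and one high word are kept out of each
    group of [2 * r + 1] upcrossings, where [r] upcrossings make the lengths
    grow enough for [packed_tower]. *)
Lemma upcrossing_count : exists (g : R) (L r : nat), [/\ 0 < g < 1, (0 < r)%N &
  forall x k M N,
  (count (fun n => `[< upcrosses_before x n k M >]) (iota 0 N))%:R <=
    g ^+ ((k - L) %/ r) * (N + M)%:R].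
Proof.
have [delta [L0 [/andP[delta0 delta1] fill]]] := high_unfilled hU hst.
pose eps := delta / 8; have eps0 : 0 < eps by rewrite divr_gt0.
have [||r hr] := @exists_expr_le R (1 - delta) (eps ^+ 2 / (1 + eps)).
- by apply/andP; split; lra.
- by rewrite divr_gt0 ?exprn_gt0 // addr_gt0.
have grow c d : c <= (1 - delta) ^+ r * d -> 0 <= d -> (1 + eps) * c <= eps ^+ 2 * d.
  move=> cd d0; have e1 : 0 < 1 + eps by rewrite addr_gt0.
  rewrite mulrC -ler_pdivlMr //; apply: le_trans cd _.
  by rewrite mulrAC ler_wpM2r.
pose L := maxn L0 (Num.bound ((1 + eps) / eps ^+ 2)).
have Lbig : (1 + eps) * 1 <= eps ^+ 2 * L%:R.
  rewrite mulr1 mulrC -ler_pdivrMr ?exprn_gt0 //.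
  apply: le_trans (ltW (archi_boundP _)) _; last by rewrite ler_nat leq_maxr.
  by rewrite divr_ge0 ?exprn_ge0 ?addr_ge0 // ltW.
(* It takes [r] upcrossings to go from a low word to a high word that outgrows
   it, and [r + 1] more to reach a low word that outgrows this high word. *)
pose rr := (2 * r + 1)%N.
exists ((1 + 2 * eps) * (1 - delta + 2 * eps)), L, rr; split.
- by rewrite /eps; apply/andP; split; nra.
- by rewrite /rr addn1.
move=> x k M N; pose K := ((k - L) %/ rr)%N; rewrite -/K.
have lk l c : (l < K)%N -> (c < rr)%N -> (L + rr * l + c < k)%N.
  move=> lK cr; have := leq_divM (k - L) rr; rewrite -/K => h.
  have : (rr * l.+1 <= K * rr)%N by rewrite mulnC leq_mul2r lK orbT.
  by rewrite mulnS; lia.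
pose A := [seq n <- iota 0 N | `[< upcrosses_before x n k M >]].
have AN n : n \in A -> (n < N)%N by rewrite mem_filter mem_iota => /andP[_].
have /boolp.choice[ij hij] : forall n, exists ij : (nat -> nat) * (nat -> nat), n \in A ->
    [/\ (1 <= ij.1 0)%N,
        forall m, (m < k)%N -> (ij.1 m < ij.2 m)%N,
        forall m, (m.+1 < k)%N -> (ij.2 m < ij.1 m.+1)%N,
        forall m, (m < k)%N -> rate x n (ij.1 m) < s /\ t < rate x n (ij.2 m)
      & forall m, (m < k)%N -> (ij.2 m <= M)%N].
  move=> n; case: (boolP (n \in A)) => [|_]; last by exists (id, id).
  by rewrite mem_filter => /andP[/asboolP[i [j h]] _]; exists (i, j).
pose i n := (ij n).1; pose j n := (ij n).2.
pose lo l n := i n (L + rr * l)%N.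
pose hi l n := if l is l'.+1 then j n (L + rr * l' + r)%N else 1%N.
have rrr : (r < rr)%N by rewrite /rr; lia.
have index n m : n \in A -> (m < k)%N -> (m < i n m)%N.
  by move=> nA; have [h1 h2 h3 _ _] := hij n nA; exact: (crossing_index h1 h2 h3).
have low n m : n \in A -> (m < k)%N -> (kappa (word x n (i n m)))%:R <= s * (i n m)%:R.
  move=> nA mk; have [_ _ _ /(_ m mk)[+ _] _] := hij n nA.
  rewrite /rate ltr_pdivrMr => [/ltW//|]; rewrite ltr0n.
  exact: leq_ltn_trans (leq0n m) (index _ _ nA mk).
have high n m : n \in A -> (m < k)%N -> t * (j n m)%:R < (kappa (word x n (j n m)))%:R.
  move=> nA mk; have [_ /(_ m mk) h2 _ /(_ m mk)[_ +] _] := hij n nA.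
  by rewrite /rate ltr_pdivlMr // ltr0n (leq_trans _ h2).
have ratio n m : n \in A -> (L <= m < k)%N -> (i n m)%:R <= (1 - delta) * (j n m)%:R :> R.
  move=> nA /andP[Lm mk]; have [_ /(_ m mk) h2 _ _ _] := hij n nA.
  have := @fill x (fun=> i n m) [:: n] n (j n m) (high _ _ nA mk).
  rewrite big_seq1; apply; first by rewrite /= leqnn leq_add2l ltnW.
  move=> m'; rewrite inE => /eqP ->; split; last exact: low.
  exact: leq_trans (leq_trans (leq_maxl _ _) Lm) (ltnW (index _ _ nA mk)).
have growth n m c : n \in A -> (L <= m)%N -> (m + r < k)%N ->
   (i n (m + r)%N <= c)%N -> (1 + eps) * (i n m)%:R <= eps ^+ 2 * c%:R.
  move=> nA Lm mk ic; apply: grow; last exact: ler0n.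
  have [h1 h2 h3 _ _] := hij n nA.
  have d0 : 0 <= 1 - delta by lra.
  have cg := crossing_growth h3 d0 (fun m' => @ratio n m' nA) Lm mk.
  apply: le_trans cg _.
  by rewrite ler_wpM2l ?exprn_ge0 ?ler_nat.
have jM n m : n \in A -> (m < k)%N -> (n + j n m <= N + M)%N.
  move=> nA mk; have [_ _ _ _ /(_ m mk) jm] := hij n nA.
  exact: leq_add (ltnW (AN n nA)) jm.
have iltj n m : n \in A -> (m < k)%N -> (i n m < j n m)%N.
  by move=> nA mk; have [_ /(_ m mk)] := hij n nA.
have lok l : (l < K)%N -> (L + rr * l < k)%N.
  by move=> lK; rewrite -[X in (X < _)%N]addn0; apply: lk => //; rewrite /rr addn1.
have hik l : (l < K)%N -> (L + rr * l + r < k)%N by move=> lK; exact: lk.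
have -> : (count (fun n => `[< upcrosses_before x n k M >]) (iota 0 N))%:R =
    \sum_(n <- A) (hi 0%N n)%:R :> R.
  by rewrite -size_filter -/A -sum1_size natr_sum.
apply: (@packed_tower R eps delta lo hi A (N + M) K eps0) =>
  [|||l n|l n|l n|l n|l n|l n S lK nA subA pk].
- lra.
- apply: (packed_filter (packed_iota 0 N)) => // m; rewrite mem_iota => /andP[_ mN] _.
  by split=> //; rewrite addn1 (leq_trans mN) // leq_addr.
- move=> l n lK nA; rewrite /outgrows; case: l lK => [|l] lK.
    apply: (le_trans Lbig); rewrite ler_wpM2l ?exprn_ge0 // ?ltW // ltr_nat.
    have L0k := lok 0%N lK; rewrite muln0 addn0 in L0k.
    by rewrite /lo muln0 addn0; exact: index.
  have h1 := hik l (ltnW lK); have h2 := lok l.+1 lK.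
  have e : (L + rr * l.+1 = (L + rr * l + r).+1 + r)%N by rewrite mulnS /rr; lia.
  rewrite /hi /lo e in h2 *.
  apply: le_trans (growth n _ _ nA _ h2 (leqnn _)); last first.
    by rewrite -addnS -addnA leq_addr.
  apply: ler_wpM2l; first by rewrite addr_ge0 // ltW.
  have [_ _ ji _ _] := hij n nA; rewrite ler_nat ltnW // ji //.
  exact: leq_ltn_trans (leq_addr _ _) h2.
- move=> lK nA; apply: growth => //; first exact: leq_addr; first exact: hik.
  by apply/ltnW/iltj => //; exact: hik.
- by move=> lK nA; exact: leq_ltn_trans (index _ _ nA (lok _ lK)).
- by move=> lK nA; exact: leq_ltn_trans (iltj _ _ nA (hik _ lK)).
- move=> lK nA; apply: leq_trans (jM _ _ nA (lok _ lK)).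
  by rewrite leq_add2l ltnW // iltj // lok.
- by move=> lK nA; apply: jM => //; exact: hik.
- apply: (fill x) pk _; first exact: high _ _ nA (hik _ lK).
  move=> m /subA mA; split; last by apply: low => //; exact: lok.
  apply: leq_trans (ltnW (index _ _ mA (lok _ lK))).
  exact: leq_trans (leq_maxl _ _) (leq_addr _ _).
Qed.
End Count.

(** * Averaging over a stationary process *)

Section Prob.
Context d (T : measurableType d) (R : realType) (P : probability T R).

Lemma measurable_word (X : nat -> {RV P >-> bool}) (A : set (seq bool)) n :
  measurable [set w | A (mkseq (fun i => X i w) n)].
Proof.
elim: n A => [|n IH] A.
  rewrite /mkseq /=; have [h|h] := pselect (A [::]).
    by rewrite (_ : [set _ | _] = setT) //; apply/seteqP; split.
  by rewrite (_ : [set _ | _] = set0) //; apply/seteqP; split.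
rewrite (_ : [set _ | _] =
  ([set w | A (rcons (mkseq (fun i => X i w) n) true)] `&` (X n @^-1` [set true])) `|`
  ([set w | A (rcons (mkseq (fun i => X i w) n) false)] `&` (X n @^-1` [set false]))).
  by apply: measurableU; apply: measurableI; try exact: measurable_funPTI;
     apply: (IH (fun u => A (rcons u _))).
apply/seteqP; split => w /=; rewrite mkseqS.
  by case: (X n w) => h; [left|right].
by move=> [] [h ->].
Qed.

(** Integrate the number of events that occur. *)
Lemma sum_probability_le (E : nat -> set T) N (C : R) :
  (forall m, measurable (E m)) ->
  (forall w, (count (fun m => w \in E m) (iota 0 N))%:R <= C) ->
  (\sum_(m <- iota 0 N) P (E m) <= C%:E)%E.
Proof.
move=> mE hC.
have -> : (\sum_(m <- iota 0 N) P (E m) =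
    \int[P]_w (\sum_(m <- iota 0 N) (\1_(E m) w)%:E))%E.
  rewrite ge0_integral_sum //.
  - by apply: eq_bigr => m _; rewrite integral_indic // setIT.
  - by move=> m; apply/measurable_EFinP; exact: measurable_indic.
apply: (@le_trans _ _ (\int[P]_w C%:E)%E); last first.
  by rewrite integral_cst //= probability_setT mule1.
apply: ge0_le_integral => //.
- by move=> w _; apply: sume_ge0.
- apply: emeasurable_sum => m; apply/measurable_EFinP; exact: measurable_indic.
- move=> w _; rewrite sumEFin lee_fin; apply: le_trans (hC w).
  rewrite -sum1_count natr_sum [leRHS]big_mkcond /=; apply: ler_sum => m _.
  by rewrite indicE; case: (_ \in _).
Qed.

End Prob.

Section Final.
Variables (U : turing_machine) (hU : universal U) (R : realType) (s t : R).
Hypothesis hst : s < t.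

Lemma word_nth x n M l : (l <= M)%N -> word (nth false (word x n M)) 0 l = word x n l.
Proof.
move=> lM; apply: (@eq_from_nth _ false); rewrite !size_word // => i il.
by rewrite !nth_mkseq // (leq_trans il).
Qed.

(** Upcrossings seen from [n] before [M] are an event about the word of length
    [M] starting at [n], the form in which stationarity applies. *)
Lemma upcrosses_before_word x n k M :
  upcrosses_before U s t x n k M <->
  upcrosses_before U s t (nth false (word x n M)) 0 k M.
Proof.
have eq_rate (l : nat) : (l <= M)%N ->
    rate U R (nth false (word x n M)) 0 l = rate U R x n l.
  by move=> lM; rewrite /rate word_nth.
split=> -[i [j [h1 h2 h3 h4 h5]]]; exists i, j; split=> // m mk;
  have [a b] := h4 m mk; have jM := h5 m mk; have iM := leq_trans (ltnW (h2 m mk)) jM.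
  by rewrite !eq_rate.
by rewrite -!eq_rate.
Qed.

Lemma upcrosses_before_mono x n k M M' : (M <= M')%N ->
  upcrosses_before U s t x n k M -> upcrosses_before U s t x n k M'.
Proof.
move=> MM' [i [j [h1 h2 h3 h4 h5]]]; exists i, j; split=> // m mk.
exact: leq_trans (h5 m mk) MM'.
Qed.

Lemma has_upcrossings_before x k :
  has_upcrossings (rate U R x 0) s t k <->
  exists M, upcrosses_before U s t x 0 k M.
Proof.
split=> [[i [j [h1 h2 h3 h4]]]|[M [i [j [h1 h2 h3 h4 _]]]]]; last by exists i, j.
(* The sum serves as a common upper bound of the [j m]. *)
exists (\sum_(m < k) j m)%N, i, j; split=> // m mk.
by rewrite (bigD1 (Ordinal mk)) //= leq_addr.
Qed.

Lemma bernoulli (x : R) r : 0 <= x <= 1 -> 1 - r%:R * x <= (1 - x) ^+ r.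
Proof.
move=> /andP[x0 x1]; elim: r => [|r IH]; first by rewrite mul0r subr0 expr0.
rewrite exprS; apply: le_trans (ler_wpM2l _ IH); last by rewrite subr_ge0.
have : 0 <= r%:R * x * x by rewrite !mulr_ge0.
by rewrite -natr1; lra.
Qed.

(** Bernoulli's inequality replaces the [r]-th root of [g] by the explicit
    number [1 - (1 - g) / r]. *)
Lemma geometric_rate (g : R) L r : 0 < g < 1 -> (0 < r)%N ->
  exists c rho : R, [/\ 0 < rho < 1, 0 < c & forall k, g ^+ ((k - L) %/ r) <= c * rho ^+ k].
Proof.
move=> /andP[g0 g1] r0; have r0' : 0 < r%:R :> R by rewrite ltr0n.
have r1 : 1 <= r%:R :> R by rewrite ler1n.
pose x := (1 - g) / r%:R.
have x0 : 0 < x by rewrite divr_gt0 ?subr_gt0.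
have x1 : x < 1 by rewrite ltr_pdivrMr // mul1r; lra.
pose rho := 1 - x; have rho0 : 0 < rho by rewrite subr_gt0.
exists (rho ^+ (L + r))^-1, rho; split.
- by rewrite rho0 /rho; lra.
- by rewrite invr_gt0 exprn_gt0.
move=> k; rewrite ler_pdivlMl ?exprn_gt0 //.
set K := (_ %/ _)%N.
have gr : g <= rho ^+ r.
  apply: le_trans (bernoulli r _); last by rewrite !ltW.
  by rewrite /x mulrC divfK ?gt_eqF //; lra.
apply: (@le_trans _ _ (rho ^+ (L + r) * (rho ^+ r) ^+ K)).
  apply: ler_wpM2l; first by rewrite exprn_ge0 // ltW.
  apply: lerXn2r => //; rewrite nnegrE; apply: ltW => //; exact: exprn_gt0.
rewrite -exprM -exprD; apply: ler_wiXn2l; rewrite ?ltW //; first by rewrite /rho; lra.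
have := ltn_ceil (k - L) r0; rewrite -/K mulSn mulnC; lia.
Qed.

Lemma upcrossing_probability : exists c rho : R, [/\ 0 < rho < 1, 0 < c &
  forall d (T : measurableType d) (P : probability T R) (X : nat -> {RV P >-> bool}),
  stationary X -> forall k M, (0 < k)%N ->
  (P [set w | upcrosses_before U s t (fun i => X i w) 0 k M] <= (c * rho ^+ k)%:E)%E].
Proof.
have [g [L [r [g01 r0 cnt]]]] := upcrossing_count hU hst.
have [c [rho [rho01 c0 hc]]] := geometric_rate L g01 r0.
exists (c * 2), rho; split=> //; first by rewrite mulr_gt0.
move=> d T P X st k M k0.
pose A : set (seq bool) := [set u | upcrosses_before U s t (nth false u) 0 k M].
pose E m := [set w | upcrosses_before U s t (fun i => X i w) m k M].
have EA m : E m = [set w | A (mkseq (fun i => X (m + i)%N w) M)].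
  apply/seteqP; split=> w.
    exact: (upcrosses_before_word (fun i => X i w) m k M).1.
  exact: (upcrosses_before_word (fun i => X i w) m k M).2.
have PE m : P (E m) = P (E 0%N) by rewrite !EA; exact: st.
have mE m : measurable (E m).
  rewrite EA; exact: (measurable_word (fun i => X (m + i)%N)).
(* With $N = M + 1$ starting points, $N + M \le 2 N$. *)
have := @sum_probability_le _ _ _ P E M.+1 (g ^+ ((k - L) %/ r) * (M.+1 + M)%:R) mE.
under eq_bigr do rewrite PE.
rewrite big_const_seq count_predT size_iota.
have fin : P (E 0%N) \is a fin_num by exact: fin_num_measure.
rewrite -/(E 0%N) -(fineK fin).
set p := fine _.
have -> : iter M.+1 (fun x => p%:E + x)%E 0%E = (M.+1%:R * p)%:E.
  by elim: M.+1 => [|n IH] /=; rewrite ?mul0r // IH -EFinD -natr1 mulrDl mul1r addrC.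
rewrite !lee_fin => h.
have {}h : M.+1%:R * p <= g ^+ ((k - L) %/ r) * (M.+1 + M)%:R.
  apply: h => w; apply: le_trans (cnt (fun i => X i w) k M M.+1).
  rewrite ler_nat; apply: eq_leq; apply: eq_count => m.
  by apply/idP/idP => [/set_mem h|/asboolP h]; [exact/asboolP|exact/mem_set].
have M0 : 0 < M.+1%:R :> R by rewrite ltr0n.
rewrite -(ler_pM2l M0); apply: le_trans h _.
have gk := hc k.
apply: (@le_trans _ _ (g ^+ ((k - L) %/ r) * (2 * M.+1%:R))).
  apply: ler_wpM2l; first by rewrite exprn_ge0 // ltW // (andP g01).1.
  by rewrite -(natrM R 2 M.+1) ler_nat; lia.
have := ler_wpM2r (ltW M0) gk; lra.
Qed.

End Final.

Theorem theorem1p4 (U : turing_machine) (hU : universal U)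
    (R : realType) (s t : R) (hst : s < t) :
  exists c rho : R, 0 < rho < 1 /\
    forall (d : measure_display) (T : measurableType d) (P : probability T R)
      (X : nat -> {RV P >-> bool}),
    stationary X ->
    forall k : nat, (0 < k)%N ->
    (P [set w | has_upcrossings (complexity_rate U R X w) s t k]
       < (c * rho ^+ k)%:E)%E.
Proof.
have [c [rho [rho01 c0 bound]]] := upcrossing_probability hU hst.
exists (c * 2), rho; split=> // d T P X stX k k0.
pose F M := [set w | upcrosses_before U s t (fun i => X i w) 0 k M].
have -> : [set w | has_upcrossings (complexity_rate U R X w) s t k] = \bigcup_M F M.
  apply/seteqP; split=> w.
    by move=> /(has_upcrossings_before U s t (fun i => X i w) k).1[M h]; exists M.
  by move=> [M _ h]; apply: (has_upcrossings_before U s t (fun i => X i w) k).2; exists M.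
have mF M : measurable (F M).
  rewrite (_ : F M = [set w | [set u | upcrosses_before U s t (nth false u) 0 k M]
    (mkseq (fun i => X i w) M)]); first exact: measurable_word.
  apply/seteqP; split=> w.
    exact: (upcrosses_before_word U s t (fun i => X i w) 0 k M).1.
  exact: (upcrosses_before_word U s t (fun i => X i w) 0 k M).2.
have cvgF : P \o F @ \oo --> P (\bigcup_M F M).
  apply: nondecreasing_cvg_mu => //; first exact: bigcup_measurable.
  move=> M M' MM'; apply/subsetPset => w; exact: upcrosses_before_mono.
apply: (@le_lt_trans _ _ (c * rho ^+ k)%:E).
  rewrite -(cvg_lim _ cvgF) //; apply: lime_le; first by apply/cvg_ex; eexists; exact: cvgF.
  by apply: nearW => M /=; exact: bound.
have rk : 0 < rho ^+ k by rewrite exprn_gt0 // (andP rho01).1.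
by rewrite lte_fin; have := mulr_gt0 c0 rk; lra.
Qed.
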